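(* Let $V:\mathbb{R}^n\to\mathbb{R}$ be continuously differentiable and convex, let $x\in\mathbb{R}^n$ and $d\in\mathbb{R}^n$ with $\|d\|=1$ and $\langle\nabla V(x),d\rangle>0$. Put $f(\alpha):=V(x-\alpha d)-V(x)$ for $\alpha\in\mathbb{R}$ and $$R:=\sup\{r : V(x-\alpha d)<V(x)\text{ for all }\alpha\in(0,r)\}\in(0,\infty].$$ Then there is a well-defined, continuous and strictly increasing mapping $\tau\mapsto\alpha(\tau)$, $\tau\in(0,\infty)$, such that $\alpha=\alpha(\tau)\neq0$ solves $$\frac{f(\alpha)}{\alpha^2}=-\frac1\tau .$$ Furthermore, the mapping $\tau\mapsto\alpha(\tau)$ is bijective from $(0,\infty)$ to $(0,R)$.
   Context: $\|\cdot\|$ and $\langle\cdot,\cdot\rangle$ are the Euclidean norm and inner product on $\mathbb{R}^n$. The equation describes one step $y=x-\alpha d$ of an Itoh--Abe type method with time step $\tau>0$ in direction $d$. *)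

(* Defs.v *)
From HB Require Import structures.
From mathcomp Require Import all_boot all_order all_algebra.
From mathcomp Require Import boolp classical_sets functions reals ereal.
From mathcomp Require Import interval_inference set_interval topology.
From mathcomp Require Import normedtype derive convex.
Set Implicit Arguments.
Unset Strict Implicit.
Unset Printing Implicit Defensive.
Import Order.TTheory GRing.Theory Num.Theory.
Import numFieldNormedType.Exports.
Local Open Scope classical_set_scope.
Local Open Scope ring_scope.

Definition inner (R : realType) (n : nat) (u v : 'rV[R]_n) : R :=
  \sum_(i < n) u 0 i * v 0 i.

(* The library's `|u| on 'rV[R]_n is the sup norm. *)
Definition enorm (R : realType) (n : nat) (u : 'rV[R]_n) : R :=
  Num.sqrt (inner u u).

Definition gradient (R : realType) (n : nat) (V : 'rV[R]_n -> R)
    (x : 'rV[R]_n) : 'rV[R]_n :=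
  \row_(i < n) 'D_(delta_mx 0 i) V x.

(* Differentiability and continuity use the sup-norm topology of 'rV[R]_n,
   which is the Euclidean one. *)
Definition continuously_differentiable (R : realType) (n : nat)
    (V : 'rV[R]_n -> R) : Prop :=
  (forall x, differentiable V x) /\ continuous (gradient V).

Definition descent_radius (R : realType) (n : nat) (V : 'rV[R]_n -> R)
    (x d : 'rV[R]_n) : \bar R :=
  ereal_sup [set r%:E | r in [set r : R |
    forall a : R, 0 < a < r -> V (x - a *: d) < V x]].

(* Main.v *)
(* Along the line, f(a) = V(x - a d) - V(x) satisfies f(ta) <= t f(a) for
   0 <= t <= 1 and has slope -c < 0 at 0, so f lies above its tangent a |-> -c a
   and (0, R) is exactly {a > 0 | f(a) < 0}.  Solutions are positive because
   f > 0 on the negative half-line.  Since f(a)/a is nondecreasing and negative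
   on (0, R), f(a)/a^2 is strictly increasing there, and the intermediate value
   theorem applied to tau f(a) + a^2, which is negative just right of 0 and
   nonnegative at c tau, gives a solution for every tau.  A monotone bijection
   between open intervals is continuous. *)
Require Import Defs.
From HB Require Import structures.
From mathcomp Require Import all_boot all_order all_algebra.
From mathcomp Require Import boolp classical_sets functions reals ereal.
From mathcomp Require Import interval_inference set_interval topology.
From mathcomp Require Import normedtype derive convex.
From mathcomp Require Import ring lra.
Set Implicit Arguments.
Unset Strict Implicit.
Unset Printing Implicit Defensive.
Import Order.TTheory GRing.Theory Num.Theory.
Import numFieldNormedType.Exports.
Local Open Scope classical_set_scope.
Local Open Scope ring_scope.

(** * One-variable functions that are star-shaped about 0 with slope [- c] there *)

Section StarConvexProfile.
Context {R : realType} (f : R -> R) (c : R).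
Hypothesis c_gt0 : 0 < c.
Hypothesis f_cont : continuous f.
Hypothesis f_star : forall t a : R, 0 <= t <= 1 -> f (t * a) <= t * f a.
Hypothesis f_slope : forall a, t^-1 * f (t * a) @[t --> 0^'+] --> - (c * a).

(** Star-shapedness gives [t^-1 * f (t * a) <= f a] for small [t > 0]; let [t] tend to 0. Negative
    [a] is included, which later rules out negative solutions. *)
Lemma profile_ge_tangent a : - (c * a) <= f a.
Proof.
apply: cvgr_to_le (@f_slope a) _.
near=> t; have t0 : 0 < t by near: t; exact: nbhs_right_gt.
rewrite ler_pdivrMl// f_star// ltW//=.
by near: t; apply: nbhs_right_le.
Unshelve. all: by end_near. Qed.

Lemma profile_lt_half_tangent : \forall t \near 0^'+, f t < - (c / 2) * t.
Proof.
have h : - (c * 1) < - (c / 2) by have := c_gt0; lra.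
have /cvgr_lt/(_ _ h) := @f_slope 1.
apply: filterS2 (nbhs_right_gt 0) => t t0.
by rewrite mulr1 ltr_pdivrMl// mulrC.
Qed.

Lemma profile_neg_downward a b : 0 < a <= b -> f b < 0 -> f a < 0.
Proof.
move=> /andP[a0 ab] fb; have b0 : 0 < b by exact: lt_le_trans ab.
have h : 0 <= a / b <= 1.
  by rewrite divr_ge0 ?(ltW a0) ?(ltW b0)//= ler_pdivrMr// mul1r.
have := f_star b h; rewrite divfK ?gt_eqF// => /le_lt_trans; apply.
by rewrite pmulr_rlt0// divr_gt0.
Qed.

(** The middle term is [f b / (a * b)]: star-shapedness bounds the left side by it, and the strict
    step uses [a < b] together with [f b < 0]. *)
Lemma profile_ratio_lt a b : 0 < a < b -> f b < 0 ->
  f a / a ^+ 2 < f b / b ^+ 2.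
Proof.
move=> /andP[a0 ab] fb; have b0 : 0 < b by exact: lt_trans ab.
have h : 0 <= a / b <= 1.
  by rewrite divr_ge0 ?(ltW a0) ?(ltW b0)//= ltW// ltr_pdivrMr// mul1r.
have := f_star b h; rewrite divfK ?gt_eqF// => fa.
apply: (@le_lt_trans _ _ (f b / (a * b))).
  rewrite ler_pdivrMr ?exprn_gt0//.
  suff -> : f b / (a * b) * a ^+ 2 = a / b * f b by [].
  by field; rewrite !gt_eqF.
rewrite ltr_nM2l// ltf_pV2 ?posrE ?exprn_gt0 ?mulr_gt0//.
by rewrite expr2 ltr_pM2r.
Qed.

Lemma profile_solvable tau : 0 < tau ->
  exists a, [/\ 0 < a, f a < 0 & f a / a ^+ 2 = - tau^-1].
Proof.
move=> t0.
have [e [e0 ect he]] : exists e,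
    [/\ 0 < e, e <= c * tau & tau * f e + e ^+ 2 < 0].
  suff /filter_ex[e [? ? ?]] : \forall e \near 0^'+,
      [/\ 0 < e, e <= c * tau & tau * f e + e ^+ 2 < 0] by exists e.
  near=> e.
  have e0 : 0 < e by near: e; exact: nbhs_right_gt.
  split=> //; first by near: e; apply: nbhs_right_le; exact: mulr_gt0.
  have fe : f e < - (c / 2) * e by near: e; exact: profile_lt_half_tangent.
  (* This bound makes [e ^+ 2] smaller than [tau * (c / 2) * e], the guaranteed decrease of
     [tau * f e]. *)
  have ee : e < tau * (c / 2).
    by near: e; apply: nbhs_right_lt; rewrite mulr_gt0// divr_gt0.
  have : tau * f e < tau * (- (c / 2) * e) by rewrite ltr_pM2l.
  have : e * e < tau * (c / 2) * e by rewrite ltr_pM2r.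
  rewrite expr2; lra.
pose h a := tau * f a + a ^+ 2.
(* At [c * tau] the tangent bound reads [tau * f (c * tau) >= - (c * tau) ^+ 2]. *)
have hb : 0 <= h (c * tau).
  have : tau * - (c * (c * tau)) <= tau * f (c * tau).
    by rewrite ler_pM2l// profile_ge_tangent.
  rewrite /h; nra.
have hc : continuous h.
  move=> z; apply: cvgD; last by rewrite expr2; apply: cvgM; exact: cvg_id.
  by apply: cvgM; [exact: cvg_cst|exact: f_cont].
have /(IVT ect (continuous_subspaceT hc)) [a] :
    Num.min (h e) (h (c * tau)) <= 0 <= Num.max (h e) (h (c * tau)).
  by rewrite ge_min le_max hb (ltW he) orbT.
rewrite in_itv/= => /andP[ea _] ha.
have a0 : 0 < a by exact: lt_le_trans ea.
have a2 : 0 < a ^+ 2 by rewrite exprn_gt0.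
have fa : f a = - a ^+ 2 / tau.
  apply: (mulfI (lt0r_neq0 t0)); move/eqP: ha; rewrite /h addr_eq0 => /eqP ->.
  by field; rewrite gt_eqF.
exists a; split=> //.
  by rewrite fa mulNr oppr_lt0 divr_gt0.
by rewrite fa; field; rewrite !gt_eqF.
Unshelve. all: by end_near. Qed.

(** Strictness below the supremum comes from continuity: [f] is still negative at some [b > a], and
    [profile_neg_downward] makes that [b] an admissible radius. *)
Lemma profile_negP a : 0 < a ->
  f a < 0 <-> (a%:E < ereal_sup [set r%:E | r in [set r : R |
    forall b : R, (0 < b < r)%R -> (f b < 0)%R]])%E.
Proof.
move=> a0; split=> [fa|/ereal_sup_gt[_ [r /= hr <-]]]; last first.
  by rewrite lte_fin => ar; apply: hr; rewrite a0.
have [b ab fb] : exists2 b, a < b & f b < 0.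
  suff /filter_ex[b []] : \forall b \near a^'+, a < b /\ f b < 0 by exists b.
  near=> b; split; near: b; first exact: nbhs_right_gt.
  by move: fa; apply: cvgr_lt; apply: cvg_at_right_filter; exact: f_cont.
apply: (@lt_le_trans _ _ b%:E); first by rewrite lte_fin.
apply: ereal_sup_ubound; exists b => //= z /andP[z0 zb].
by apply: profile_neg_downward fb; rewrite z0 ltW.
Unshelve. all: by end_near. Qed.

Lemma profile_solution_neg tau a : 0 < tau -> a <> 0 ->
  f a / a ^+ 2 = - tau^-1 -> 0 < a /\ f a < 0.
Proof.
move=> t0 /eqP a0 fa; have a2 : 0 < a ^+ 2 by rewrite exprn_even_gt0.
have fa0 : f a < 0.
  by rewrite -(pmulr_llt0 (x := (a ^+ 2)^-1)) ?invr_gt0// fa oppr_lt0 invr_gt0.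
split=> //; have := profile_ge_tangent a.
have := c_gt0; nra.
Qed.

(** The Boolean equality serves monotonicity, injectivity and, with [sig = tau], uniqueness. *)
Lemma profile_solution_lt tau sig a b : 0 < tau -> 0 < sig ->
  0 < a -> f a < 0 -> f a / a ^+ 2 = - tau^-1 ->
  0 < b -> f b < 0 -> f b / b ^+ 2 = - sig^-1 ->
  (a < b) = (tau < sig).
Proof.
move=> t0 s0 a0 fa Ea b0 fb Eb.
have -> : (tau < sig) = (f a / a ^+ 2 < f b / b ^+ 2).
  by rewrite Ea Eb ltrN2 ltf_pV2 ?posrE.
case: (ltgtP a b) => [ab|ba|->]; last by rewrite ltxx.
  by rewrite profile_ratio_lt// a0.
by rewrite ltNge ltW// profile_ratio_lt// b0.
Qed.

Lemma profile_inverse : exists alpha : R -> R,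
  [/\ forall tau, 0 < tau ->
        unique (fun a : R => a <> 0 /\ f a / a ^+ 2 = - tau^-1) (alpha tau),
      {within `]0, +oo[, continuous alpha},
      {in `]0, +oo[ &, {homo alpha : s t / s < t}} &
      set_bij `]0, +oo[ [set a | 0 < a /\ f a < 0] alpha].
Proof.
(* Guarding by [0 < tau] under the existential yields a total [alpha]; the witness 0 for [tau <= 0]
   is a dummy. *)
have /choice[alpha al] : forall tau, exists a, 0 < tau ->
    [/\ 0 < a, f a < 0 & f a / a ^+ 2 = - tau^-1].
  move=> tau; case: (ltP 0 tau) => [/profile_solvable[a ?]|_]; first by exists a.
  by exists 0.
have al_lt s t : 0 < s -> 0 < t -> (alpha s < alpha t) = (s < t).
  by move=> s0 t0; case: (al _ s0) => ? ? ?; case: (al _ t0) => ? ? ?;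
    exact: profile_solution_lt.
(* Solving the equation for the time step gives [- (a ^+ 2 / f a)], the explicit inverse of
   [alpha]. *)
have al_lt_eq s a : 0 < s -> 0 < a -> f a < 0 ->
    ((alpha s < a) = (s < - (a ^+ 2 / f a))) *
    ((a < alpha s) = (- (a ^+ 2 / f a) < s)).
  move=> s0 a0 fa; have a2 : 0 < a ^+ 2 by rewrite exprn_gt0.
  have u0 : 0 < - (a ^+ 2 / f a) by rewrite oppr_gt0 pmulr_rlt0// invr_lt0.
  have Ea : f a / a ^+ 2 = - (- (a ^+ 2 / f a))^-1.
    by rewrite invrN opprK invf_div.
  by case: (al _ s0) => ? ? ?; split; apply: profile_solution_lt.
have al_inv a : 0 < a -> f a < 0 ->
    0 < - (a ^+ 2 / f a) /\ alpha (- (a ^+ 2 / f a)) = a.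
  move=> a0 fa; have a2 : 0 < a ^+ 2 by rewrite exprn_gt0.
  have u0 : 0 < - (a ^+ 2 / f a) by rewrite oppr_gt0 pmulr_rlt0// invr_lt0.
  split=> //; apply/eqP; rewrite eq_le !leNgt.
  by rewrite !al_lt_eq// !ltxx.
exists alpha; split.
- move=> tau t0; have [a0 fa Ea] := al _ t0; split.
    by split=> //; apply/eqP; rewrite gt_eqF.
  move=> b [b0 Eb]; have [{}b0 fb] := profile_solution_neg t0 b0 Eb.
  apply/eqP; rewrite eq_le !leNgt.
  rewrite (profile_solution_lt t0 t0 a0 fa Ea)//.
  by rewrite (profile_solution_lt t0 t0 b0 fb Eb)// ltxx.
- rewrite continuous_open_subspace; last exact: interval_open.
  move=> s; rewrite inE/= in_itv/= andbT => s0.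
  have [a0 fa Ea] := al _ s0.
  apply/(@cvgrPdist_lt _ R^o) => e e0.
  (* Bracket [alpha s] within [e] by points [d < alpha s < b] where [f] is negative; every [t]
     between their inverse images then has [alpha t] between [d] and [b]. *)
  have [b [ab be fb]] : exists b, [/\ alpha s < b, b < alpha s + e & f b < 0].
    suff /filter_ex[b []] : \forall b \near (alpha s)^'+,
      [/\ alpha s < b, b < alpha s + e & f b < 0] by exists b.
    near=> b; split; near: b; first exact: nbhs_right_gt.
      by apply: nbhs_right_lt; rewrite ltrDl.
    by move: fa; apply: cvgr_lt; apply: cvg_at_right_filter; exact: f_cont.
  have b0 := lt_trans a0 ab.
  have [d [d0 da de]] : exists d, [/\ 0 < d, d < alpha s & alpha s - e < d].
    (* The first argument keeps [d] positive, the second keeps it within [e] of [alpha s]. *)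
    exists (Num.max (alpha s / 2) (alpha s - e / 2)).
    rewrite lt_max gt_max lt_max; split; [|apply/andP; split|]; lra.
  have fd : f d < 0 by apply: profile_neg_downward fa; rewrite d0 ltW.
  near=> t.
  have t0 : 0 < t by near: t; exact: lt_nbhsr.
  have tb : alpha t < b.
    rewrite al_lt_eq//; near: t; apply: lt_nbhsl.
    by rewrite -al_lt_eq.
  have td : d < alpha t.
    rewrite al_lt_eq//; near: t; apply: lt_nbhsr.
    by rewrite -al_lt_eq.
  by rewrite ltr_norml; apply/andP; split; lra.
- move=> s t; rewrite !in_itv/= !andbT => s0 t0 st.
  by rewrite al_lt.
- split.
  + by move=> t /=; rewrite in_itv/= andbT => /al[].
  + move=> s t; rewrite !inE/= !in_itv/= !andbT => s0 t0 st.
    by apply/eqP; rewrite eq_le !leNgt -(al_lt s t)// -(al_lt t s)// st ltxx.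
  + move=> a [a0 fa]; have [u0 ua] := al_inv _ a0 fa.
    by exists (- (a ^+ 2 / f a)) => //=; rewrite in_itv/= andbT.
Unshelve. all: by end_near. Qed.

End StarConvexProfile.

(** * Restriction of a convex function to a line *)

Lemma derive_gradient (R : realType) (n : nat) (V : 'rV[R]_n -> R)
    (x v : 'rV[R]_n) :
  differentiable V x -> 'D_v V x = inner (gradient V x) v.
Proof.
move=> dV; rewrite deriveE// [in LHS](row_sum_delta v) linear_sum.
apply: eq_bigr => i _.
by rewrite linearZ/= mxE deriveE// mulrC.
Qed.

Lemma inner_scaler (R : realType) (n : nat) (u v : 'rV[R]_n) (a : R) :
  inner u (a *: v) = a * inner u v.
Proof.
by rewrite /inner mulr_sumr; apply: eq_bigr => i _; rewrite mxE mulrCA.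
Qed.

Lemma convex_function_star (R : realType) (E : lmodType R) (V : E -> R)
    (x v : E) (t : R) :
  convex_function [set: E] V -> 0 <= t <= 1 ->
  V (x + t *: v) - V x <= t * (V (x + v) - V x).
Proof.
move=> Vc t01; pose p : {i01 R} := Itv01 (andP t01).1 (andP t01).2.
have := Vc p (x + v) x (mem_set I) (mem_set I).
rewrite convRE /conv/= /unstable.onem => h.
have -> : x + t *: v = t *: (x + v) + (1 - t) *: x.
  by rewrite scalerDr scalerBl scale1r [RHS]addrC addrA subrK.
lra.
Qed.

Theorem proposition5p3 (R : realType) (n : nat) (V : 'rV[R]_n -> R)
    (x d : 'rV[R]_n)
    (V_C1 : continuously_differentiable V)
    (V_convex : convex_function [set: 'rV[R]_n] V)
    (d_unit : enorm d = 1)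
    (grad_gt0 : 0 < inner (gradient V x) d) :
  let f := fun a : R => V (x - a *: d) - V x in
  let Rsup := descent_radius V x d in
  (0 < Rsup)%E /\
  exists alpha : R -> R,
    [/\ forall tau : R, 0 < tau ->
          unique (fun a : R => a <> 0 /\ f a / a ^+ 2 = - (1 / tau))
                 (alpha tau),
        {within `]0, +oo[, continuous alpha},
        {in `]0, +oo[ &, {homo alpha : s t / s < t}} &
        set_bij `]0, +oo[ [set a : R | 0 < a /\ (a%:E < Rsup)%E] alpha].
Proof.
move=> f Rsup; have [dV _] := V_C1.
have f_star (t a : R) : 0 <= t <= 1 -> f (t * a) <= t * f a.
  move=> t01; rewrite /f -!scalerN -scalerA.
  exact: convex_function_star.
have f_slope a :
    t^-1 * f (t * a) @[t --> 0^'+] --> - (inner (gradient V x) d * a).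
  (* The quotient is the difference quotient of [V] at [x] in direction [a *: - d]. *)
  have -> : - (inner (gradient V x) d * a) = 'D_(a *: - d) V x.
    by rewrite scalerN -scaleNr derive_gradient// inner_scaler mulrC mulNr.
  apply: cvg_dnbhs_at_right.
  under eq_fun do rewrite /f -scalerN -scalerA (addrC x).
  exact: (diff_derivable (v := a *: - d) (dV x)).
have f_cont : continuous f.
  move=> a; apply: cvgB; last exact: cvg_cst.
  apply: (@cvg_comp _ _ _ (fun t => x - t *: d) V _ (nbhs (x - a *: d))).
    by apply: cvgB; [exact: cvg_cst|exact: scalel_continuous].
  exact: (differentiable_continuous (dV (x - a *: d))).
have RsupE : Rsup = ereal_sup [set r%:E | r in [set r : R |
    forall b : R, (0 < b < r)%R -> (f b < 0)%R]].
  rewrite /Rsup /descent_radius; congr (ereal_sup (_ @` _)); apply/seteqP.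
  by split=> r /= hr b /hr; rewrite subr_lt0.
have negE : [set a : R | 0 < a /\ (a%:E < Rsup)%E] = [set a | 0 < a /\ f a < 0].
  rewrite RsupE; apply/seteqP.
  by split=> a /= [a0 /(profile_negP f_cont f_star a0)].
split.
  (* The solution for time step 1 is a positive point below [Rsup]. *)
  have [a [a0 fa _]] := profile_solvable grad_gt0 f_cont f_star f_slope ltr01.
  have : [set a : R | 0 < a /\ (a%:E < Rsup)%E] a by rewrite negE.
  by move=> [_]; apply: lt_trans; rewrite lte_fin.
have [alpha [al1 al2 al3 al4]] := profile_inverse grad_gt0 f_cont f_star f_slope.
exists alpha; rewrite negE; split=> // tau t0.
by rewrite div1r; exact: al1.
Qed.
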